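(* Given a groupoid $\mathcal G$ and any family $\mathcal K=\{K_A\}_{A\in\mathcal G}$ of groups indexed by the objects of $\mathcal G$, there is a bijection $$H^2_{|\mathsf{AUT}(\mathcal K)|}(\mathcal G,\mathcal K)\;\cong\;\mathsf{Sset}_*\big[\mathsf{Ner}(\mathcal G),\mathsf{Ner}(\mathsf{AUT}(\mathcal K))\big],$$ where the left-hand side is the 2-dimensional cohomology set of $\mathcal G$ with coefficients in the 2-groupoid $\mathsf{AUT}(\mathcal K)$ and, on the right-hand side, the star and the square brackets mean normalized homotopy classes of simplicial maps $\mathsf{Ner}(\mathcal G)\to\mathsf{Ner}(\mathsf{AUT}(\mathcal K))$.
   Context: Groupoids are small categories in which every arrow is invertible. Composition is written right to left: for $A\xrightarrow{u}B\xrightarrow{v}C$ the composite is $vu$. $\mathsf{Sset}$ is the category of simplicial sets. **The 2-groupoid $\mathsf{AUT}(\mathcal K)$.** Its objects are the groups $K_A$; its 1-cells are the group isomorphisms between them; a 2-cell $f\to g$ between isomorphisms $f,g:K_A\to K_B$ is an element $\alpha\in K_B$ with $g(x)\alpha=\alpha f(x)$ for all $x\in K_A$. Vertical composition of $\alpha:f\to g$ and $\beta:g\to h$ is the product $\beta\alpha$. Horizontal composition of $\alpha:f\to h$ ($f,h:K_A\to K_B$) followed by $\beta:g\to k$ ($g,k:K_B\to K_C$) is $\beta\, g(\alpha): gf\to kh$. Its underlying category (objects and 1-cells) is denoted $|\mathsf{AUT}(\mathcal K)|$. **Cohomology.** A weak action (2-cocycle) of $\mathcal G$ on $\mathcal K$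 is a normalized lax 2-functor $\mathcal G\to\mathsf{AUT}(\mathcal K)$ sending each object $A$ to $K_A$. Explicitly, it is a pair $(F,\sigma)$ where $F$ assigns to each arrow $u:A\to B$ of $\mathcal G$ a group isomorphism $F(u):K_A\to K_B$, and $\sigma$ assigns to each composable pair $A\xrightarrow{u}B\xrightarrow{v}C$ an element $\sigma_{vu}\in K_C$, such that for all 3-chains $A\xrightarrow{u}B\xrightarrow{v}C\xrightarrow{w}D$ and $x\in K_A$: $F(1_A)(x)=x$; $\sigma_{1_A1_A}=1$; $\sigma_{vu}\,F(vu)(x)=F(v)(F(u)(x))\,\sigma_{vu}$; $\sigma_{wv}\,\sigma_{(wv)u}=F(w)(\sigma_{vu})\,\sigma_{w(vu)}$. A morphism $(F_1,\sigma^1)\to(F_2,\sigma^2)$ of weak actions is a family of maps of sets $\tau_{AB}:\mathcal G(A,B)\to K_B$ such that for all $A\xrightarrow{u}B\xrightarrow{v}C$ in $\mathcal G$ and $k\in K_A$: $\tau_{AB}(u)\,F_1(u)(k)=F_2(u)(k)\,\tau_{AB}(u)$; $\tau_{AA}(1_A)=1$; $F_2(v)(\tau_{AB}(u))\,\tau_{BC}(v)\,\sigma^1_{vu}=\sigma^2_{vu}\,\tau_{AC}(vu)$. Composition is by pointwise product. $H^2_{|\mathsf{AUT}(\mathcal K)|}(\mathcal G,\mathcal K)$ is by definition the set of connected components of the resulting category of weak actions. **Lax 2-functors.** For 2-categories $\mathbf A,\mathbf B$ (composition of 2-cells: vertical by juxtaposition, horizontal $*$; whiskering with a 1-cell $f$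 means $*$ with $\mathrm{id}_f$), a (normal) lax 2-functor $(F,\sigma):\mathbf A\to\mathbf B$ consists of an object function $F$, functors $F:\mathbf A(X,Y)\to\mathbf B(F(X),F(Y))$, and 2-cells $\sigma_{gf}:F(gf)\to F(g)F(f)$, natural in composable $f,g$, such that $F(1_X)=1_{F(X)}$; $(\sigma_{hg}*F(f))\,\sigma_{(hg)f}=(F(h)*\sigma_{gf})\,\sigma_{h(gf)}$ for composable $f,g,h$; and $\sigma_{f1_X}=\mathrm{id}_{F(f)}=\sigma_{1_Yf}$ for $f:X\to Y$. The composite of $(F,\sigma)$ with $(G,\rho):\mathbf B\to\mathbf C$ has structure 2-cells $\rho_{F(g)F(f)}\,G(\sigma_{gf})$. Categories (in particular the ordinals $[n]=\{0\le1\le\dots\le n\}$ and the groupoid $\mathcal G$) are regarded as 2-categories with only identity 2-cells. **Geometric nerve.** For a small 2-category $\mathbf A$, $\mathsf{Ner}(\mathbf A)$ is the simplicial set whose $n$-simplices are the lax 2-functors $[n]\to\mathbf A$, with faces and degeneracies given by precomposition with monotone maps. Thus 0-simplices are the objects of $\mathbf A$, 1-simplices the 1-cells, and 2-simplices are given by $f:A_0\to A_1$, $g:A_1\to A_2$, $h:A_0\to A_2$ and a 2-cell $h\to gf$. The nerve of $\mathcal G$ is its usual nerve. **Normalized homotopy.** A homotopy between simplicial maps $\varphi,\psi:\mathsf{Ner}(\mathcal G)\to\mathsf{Ner}(\mathsf{AUT}(\mathcal K))$ is called normalized if its component $h_{00}$, sending each vertex (object) $A$ of $\mathsf{Ner}(\mathcal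 G)$ to a 1-simplex of $\mathsf{Ner}(\mathsf{AUT}(\mathcal K))$ (an arrow of $|\mathsf{AUT}(\mathcal K)|$), takes every object $A$ to an identity arrow; viewing a homotopy as a map $\mathsf{Ner}(\mathcal G)\times\Delta[1]\to\mathsf{Ner}(\mathsf{AUT}(\mathcal K))$, this means that for every object $A$ the edge $\{A\}\times\Delta[1]$ is sent to an identity (degenerate) 1-simplex. Normalized homotopy classes are classes for the equivalence relation generated by the existence of a normalized homotopy.
   Formalization: The simplicial maps Ner(G) → Ner(AUT(K)) are required to send each vertex A to the vertex K_A; without this the bijection fails, e.g. for G discrete on two objects with K_A trivial and K_B = Z/2 (one class on the left, four on the right). *)

(* Defs.v *)
From Stdlib Require Import Relations.Relation_Operators.
From mathcomp Require Import all_boot.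
From mathcomp Require Import boolp.

Set Implicit Arguments.
Unset Strict Implicit.
Unset Printing Implicit Defensive.

Record category := Category {
  cob :> Type;
  chom : cob -> cob -> Type;
  cid : forall x, chom x x;
  ccomp : forall x y z, chom y z -> chom x y -> chom x z;
  ccompA : forall x y z w (h : chom z w) (g : chom y z) (f : chom x y),
    ccomp (ccomp h g) f = ccomp h (ccomp g f);
  ccomp1f : forall x y (f : chom x y), ccomp (cid y) f = f;
  ccompf1 : forall x y (f : chom x y), ccomp f (cid x) = f
}.
Arguments cid {c} x.
Arguments ccomp {c x y z} g f.

Record groupoid := Groupoid {
  gcat :> category;
  ginv : forall x y : gcat, chom x y -> chom y x;
  ginvf : forall (x y : gcat) (f : chom x y), ccomp (ginv f) f = cid x;
  gfinv : forall (x y : gcat) (f : chom x y), ccomp f (ginv f) = cid y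
}.

Record functor (C D : category) := Functor {
  fob :> C -> D;
  fhom : forall x y, chom x y -> chom (fob x) (fob y);
  fhom1 : forall x, fhom (cid x) = cid (fob x);
  fhomM : forall x y z (g : chom y z) (f : chom x y),
    fhom (ccomp g f) = ccomp (fhom g) (fhom f)
}.
Arguments fhom {C D} f {x y} _ : rename.

Lemma functor_ext (C D : category) (o : C -> D)
    (h h' : forall x y, chom x y -> chom (o x) (o y)) p q p' q' :
  (forall x y f, h x y f = h' x y f) ->
  @Functor C D o h p q = @Functor C D o h' p' q'.
Proof.
move=> E; have {}E : h = h' by do 3 (apply: functional_extensionality_dep => ?).
case: _ / E p' q' => p' q'.
by rewrite (Prop_irrelevance p p') (Prop_irrelevance q q').
Qed.

Definition functor_id (C : category) : functor C C.
Proof. by exists id (fun _ _ f => f). Defined.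

Definition functor_comp (C D E : category) (F' : functor D E) (F : functor C D) :
  functor C E.
Proof.
exists (fun x => F' (F x)) (fun _ _ f => fhom F' (fhom F f)).
- by move=> x; rewrite !fhom1.
- by move=> x y z g f; rewrite !fhomM.
Defined.

Lemma functor_compf1 (C D : category) (F : functor C D) :
  functor_comp F (functor_id C) = F.
Proof. by case: F => o h p q; apply: functor_ext. Qed.

Lemma functor_compA (C D E H : category) (F3 : functor E H) (F2 : functor D E)
    (F1 : functor C D) :
  functor_comp (functor_comp F3 F2) F1 = functor_comp F3 (functor_comp F2 F1).
Proof. exact: functor_ext. Qed.

(* [same_cell a b] is equality of two 2-cells whose boundaries are equal, but
   not necessarily convertible, 1-cells: the boundaries are part of the data
   compared.  It is needed to state strict laws such as the associativity of
   horizontal composition. *)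
Definition with_boundary (X : Type) (T : X -> X -> Type) x y (a : T x y) :
  {p : X * X & T p.1 p.2} := existT (fun p => T p.1 p.2) (x, y) a.

Definition same_cell (X : Type) (T : X -> X -> Type) x y (a : T x y)
  x' y' (b : T x' y') : Prop := with_boundary a = with_boundary b.

(* [vcomp b a] and [hcomp b a] both have [a] as the first cell traversed. *)
Record twocat := TwoCat {
  tob :> Type;
  cell1 : tob -> tob -> Type;
  cell2 : forall X Y, cell1 X Y -> cell1 X Y -> Type;
  id1 : forall X, cell1 X X;
  comp1 : forall X Y Z, cell1 Y Z -> cell1 X Y -> cell1 X Z;
  id2 : forall X Y (f : cell1 X Y), cell2 f f;
  vcomp : forall X Y (f g h : cell1 X Y), cell2 g h -> cell2 f g -> cell2 f h;
  hcomp : forall X Y Z (g g' : cell1 Y Z) (f f' : cell1 X Y),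
    cell2 g g' -> cell2 f f' -> cell2 (comp1 g f) (comp1 g' f');
  comp1A : forall X Y Z W (h : cell1 Z W) (g : cell1 Y Z) (f : cell1 X Y),
    comp1 (comp1 h g) f = comp1 h (comp1 g f);
  comp1_1f : forall X Y (f : cell1 X Y), comp1 (id1 Y) f = f;
  comp1_f1 : forall X Y (f : cell1 X Y), comp1 f (id1 X) = f;
  vcompA : forall X Y (f g h k : cell1 X Y)
    (c : cell2 h k) (b : cell2 g h) (a : cell2 f g),
    vcomp (vcomp c b) a = vcomp c (vcomp b a);
  vcomp_1a : forall X Y (f g : cell1 X Y) (a : cell2 f g), vcomp (id2 g) a = a;
  vcomp_a1 : forall X Y (f g : cell1 X Y) (a : cell2 f g), vcomp a (id2 f) = a;
  hcomp_id2 : forall X Y Z (g : cell1 Y Z) (f : cell1 X Y),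
    hcomp (id2 g) (id2 f) = id2 (comp1 g f);
  interchange : forall X Y Z (g g' g'' : cell1 Y Z) (f f' f'' : cell1 X Y)
    (b' : cell2 g' g'') (b : cell2 g g') (a' : cell2 f' f'') (a : cell2 f f'),
    hcomp (vcomp b' b) (vcomp a' a) = vcomp (hcomp b' a') (hcomp b a);
  hcompA : forall X Y Z W (h h' : cell1 Z W) (g g' : cell1 Y Z)
    (f f' : cell1 X Y) (c : cell2 h h') (b : cell2 g g') (a : cell2 f f'),
    same_cell (T := @cell2 X W) (hcomp (hcomp c b) a) (hcomp c (hcomp b a));
  hcomp_1a : forall X Y (f f' : cell1 X Y) (a : cell2 f f'),
    same_cell (T := @cell2 X Y) (hcomp (id2 (id1 Y)) a) a;
  hcomp_a1 : forall X Y (f f' : cell1 X Y) (a : cell2 f f'),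
    same_cell (T := @cell2 X Y) (hcomp a (id2 (id1 X))) a
}.
Arguments cell1 {t} X Y.
Arguments cell2 {t X Y} f g.
Arguments id1 {t} X.
Arguments comp1 {t X Y Z} g f.
Arguments id2 {t X Y} f.
Arguments vcomp {t X Y f g h} b a.
Arguments hcomp {t X Y Z g g' f f'} b a.

Notation "a =2c b" := (same_cell (T := @cell2 _ _ _) a b)
  (at level 70, no associativity).

Lemma same_cell_of_eq (X : Type) (x y x' y' : X) (p : x = y) (q : x' = y') :
  x = x' -> same_cell (T := fun u v : X => u = v) p q.
Proof. by move=> E; subst. Qed.

Definition locally_discrete (C : category) : twocat.
Proof.
pose hc (X Y Z : C) (g g' : chom Y Z) (f f' : chom X Y) (b : g = g')
  (a : f = f') : ccomp g f = ccomp g' f' := f_equal2 ccomp b a.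
refine (@TwoCat C (@chom C) (fun X Y f g => f = g) (@cid C) (@ccomp C)
  (fun X Y f => erefl f) (fun X Y f g h b a => etrans a b) hc
  (@ccompA C) (@ccomp1f C) (@ccompf1 C) _ _ _ _ _ _ _ _).
- by move=> *; apply: Prop_irrelevance.
- by move=> *; apply: Prop_irrelevance.
- by move=> *; apply: Prop_irrelevance.
- by move=> *; apply: Prop_irrelevance.
- by move=> *; apply: Prop_irrelevance.
- by move=> *; apply: same_cell_of_eq; rewrite ccompA.
- by move=> *; apply: same_cell_of_eq; rewrite ccomp1f.
- by move=> *; apply: same_cell_of_eq; rewrite ccompf1.
Defined.

Section SameCell.
Variables (X : Type) (T : X -> X -> Type).

Lemma same_ind x y (a : T x y) x' y' (b : T x' y')
    (P : forall u v, T u v -> Prop) :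
  same_cell a b -> P x y a -> P x' y' b.
Proof.
move=> E; change (P (projT1 (with_boundary a)).1 (projT1 (with_boundary a)).2
  (projT2 (with_boundary a)) -> P x' y' b).
by rewrite E.
Qed.

Lemma same_sym x y (a : T x y) x' y' (b : T x' y') :
  same_cell a b -> same_cell b a.
Proof. exact: esym. Qed.

Lemma same_trans x y (a : T x y) x' y' (b : T x' y') x'' y'' (c : T x'' y'') :
  same_cell a b -> same_cell b c -> same_cell a c.
Proof. exact: etrans. Qed.

Lemma same_eq x y (a b : T x y) : same_cell a b -> a = b.
Proof.
move=> E; pose P u v (c : T u v) := forall (e1 : u = x) (e2 : v = y),
  a = eq_rect u (fun s => T s y) (eq_rect v (fun s => T u s) c y e2) x e1.
have /(_ erefl erefl) // : P x y b.
apply: (same_ind (P := P) E) => e1 e2.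
by rewrite (Prop_irrelevance e1 erefl) (Prop_irrelevance e2 erefl).
Qed.

End SameCell.

Lemma same_vcomp (B : twocat) (X Y : B) (f g h f' g' h' : cell1 X Y)
    (b : cell2 g h) (a : cell2 f g) (b' : cell2 g' h') (a' : cell2 f' g') :
  b =2c b' -> a =2c a' -> vcomp b a =2c vcomp b' a'.
Proof.
move=> Eb.
apply: (same_ind (P := fun u v (c : cell2 u v) =>
  forall s (d : cell2 s u), a =2c d -> vcomp b a =2c vcomp c d) Eb) => s d Ea.
pose P u v (c : cell2 u v) := forall e : v = g,
  vcomp b a =2c vcomp b (eq_rect v (fun s => cell2 u s) c g e).
have /(_ erefl) // : P s g d.
by apply: (same_ind (P := P) Ea) => e; rewrite (Prop_irrelevance e erefl).
Qed.

Lemma same_hcomp (B : twocat) (X Y Z : B) (g1 g2 g1' g2' : cell1 Y Z)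
    (f1 f2 f1' f2' : cell1 X Y) (b : cell2 g1 g2) (a : cell2 f1 f2)
    (b' : cell2 g1' g2') (a' : cell2 f1' f2') :
  b =2c b' -> a =2c a' -> hcomp b a =2c hcomp b' a'.
Proof.
move=> Eb Ea.
apply: (same_ind (P := fun u v (c : cell2 u v) =>
  hcomp b a =2c hcomp c a') Eb).
exact: (same_ind (P := fun u v (c : cell2 u v) =>
  hcomp b a =2c hcomp b c) Ea).
Qed.

Record laxfun (A B : twocat) := LaxFun {
  lob :> A -> B;
  lhom1 : forall X Y, cell1 X Y -> cell1 (lob X) (lob Y);
  lhom2 : forall X Y (f g : cell1 X Y), cell2 f g -> cell2 (lhom1 f) (lhom1 g);
  lsig : forall X Y Z (g : cell1 Y Z) (f : cell1 X Y),
    cell2 (lhom1 (comp1 g f)) (comp1 (lhom1 g) (lhom1 f));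
  lhom2_id : forall X Y (f : cell1 X Y), lhom2 (id2 f) = id2 (lhom1 f);
  lhom2_vcomp : forall X Y (f g h : cell1 X Y) (b : cell2 g h) (a : cell2 f g),
    lhom2 (vcomp b a) = vcomp (lhom2 b) (lhom2 a);
  lsig_nat : forall X Y Z (g g' : cell1 Y Z) (f f' : cell1 X Y)
    (b : cell2 g g') (a : cell2 f f'),
    vcomp (lsig g' f') (lhom2 (hcomp b a)) =
    vcomp (hcomp (lhom2 b) (lhom2 a)) (lsig g f);
  lhom1_id : forall X, lhom1 (id1 X) = id1 (lob X);
  lsigA : forall X Y Z W (h : cell1 Z W) (g : cell1 Y Z) (f : cell1 X Y),
    vcomp (hcomp (lsig h g) (id2 (lhom1 f))) (lsig (comp1 h g) f) =2c
    vcomp (hcomp (id2 (lhom1 h)) (lsig g f)) (lsig h (comp1 g f));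
  lsig_f1 : forall X Y (f : cell1 X Y), lsig f (id1 X) =2c id2 (lhom1 f);
  lsig_1f : forall X Y (f : cell1 X Y), lsig (id1 Y) f =2c id2 (lhom1 f)
}.
Arguments lhom1 {A B} l {X Y} _.
Arguments lhom2 {A B} l {X Y f g} _.
Arguments lsig {A B} l {X Y Z} g f.

Lemma laxfun_ext (A B : twocat) (o : A -> B)
    (h1 : forall X Y, cell1 X Y -> cell1 (o X) (o Y))
    (h2 h2' : forall X Y (f g : cell1 X Y),
       cell2 f g -> cell2 (h1 X Y f) (h1 X Y g))
    (s s' : forall X Y Z (g : cell1 Y Z) (f : cell1 X Y),
       cell2 (h1 X Z (comp1 g f)) (comp1 (h1 Y Z g) (h1 X Y f)))
    p1 p2 p3 p4 p5 p6 p7 q1 q2 q3 q4 q5 q6 q7 :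
  (forall X Y f g a, h2 X Y f g a = h2' X Y f g a) ->
  (forall X Y Z g f, s X Y Z g f = s' X Y Z g f) ->
  @LaxFun A B o h1 h2 s p1 p2 p3 p4 p5 p6 p7 =
  @LaxFun A B o h1 h2' s' q1 q2 q3 q4 q5 q6 q7.
Proof.
move=> E1 E2.
have {}E1 : h2 = h2' by do 5 (apply: functional_extensionality_dep => ?).
have {}E2 : s = s' by do 5 (apply: functional_extensionality_dep => ?).
case: _ / E1 q1 q2 q3 q4 q5 q6 q7 => q1 q2 q3 q4 q5 q6 q7.
case: _ / E2 q3 q5 q6 q7 => q3 q5 q6 q7.
by rewrite (Prop_irrelevance p1 q1) (Prop_irrelevance p2 q2)
  (Prop_irrelevance p3 q3) (Prop_irrelevance p4 q4) (Prop_irrelevance p5 q5)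
  (Prop_irrelevance p6 q6) (Prop_irrelevance p7 q7).
Qed.

Section LaxCongruence.
Variables (A B : twocat) (F : laxfun A B).

Lemma same_lhom2 (X Y : A) (f g f' g' : cell1 X Y) (a : cell2 f g)
  (b : cell2 f' g') : a =2c b -> lhom2 F a =2c lhom2 F b.
Proof.
by move=> E; apply: (same_ind (P := fun _ _ c => lhom2 F a =2c lhom2 F c) E).
Qed.

Lemma same_lsig (X Y Z : A) (g g' : cell1 Y Z) (f f' : cell1 X Y) :
  g = g' -> f = f' -> lsig F g f =2c lsig F g' f'.
Proof. by move=> -> ->. Qed.

End LaxCongruence.

Lemma same_id2 (B : twocat) (X Y : B) (f f' : cell1 X Y) :
  f = f' -> id2 f =2c id2 f'.
Proof. by move=> ->. Qed.

Definition laxfun_comp (A B C : twocat) (G : laxfun B C) (F : laxfun A B) :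
  laxfun A C.
Proof.
exists (fun X => G (F X)) (fun X Y f => lhom1 G (lhom1 F f))
  (fun X Y f g a => lhom2 G (lhom2 F a))
  (fun X Y Z g f => vcomp (lsig G (lhom1 F g) (lhom1 F f)) (lhom2 G (lsig F g f))).
- by move=> X Y f; rewrite !lhom2_id.
- by move=> X Y f g h b a; rewrite !lhom2_vcomp.
- move=> X Y Z g g' f f' b a.
  by rewrite vcompA -lhom2_vcomp lsig_nat lhom2_vcomp -!vcompA lsig_nat.
- by move=> X; rewrite !lhom1_id.
- move=> X Y Z W h g f.
  set Gh := lhom1 G (lhom1 F h); set Gf := lhom1 G (lhom1 F f).
  have -> : id2 Gf = vcomp (id2 Gf) (lhom2 G (id2 (lhom1 F f))).
    by rewrite lhom2_id vcomp_1a.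
  have -> : id2 Gh = vcomp (id2 Gh) (lhom2 G (id2 (lhom1 F h))).
    by rewrite lhom2_id vcomp_1a.
  rewrite !interchange !vcompA.
  rewrite -(vcompA (hcomp (lhom2 G (lsig F h g)) _)) -lsig_nat.
  rewrite -(vcompA (hcomp (lhom2 G (id2 (lhom1 F h))) _)) -lsig_nat.
  rewrite !vcompA -!lhom2_vcomp -!vcompA.
  by apply: same_vcomp; [exact: lsigA | apply: same_lhom2; exact: lsigA].
- move=> X Y f; rewrite -[X in _ =2c X]vcomp_1a; apply: same_vcomp.
    apply: same_trans (same_lsig _ erefl (lhom1_id F X)) (lsig_f1 _ _).
  by rewrite -lhom2_id; apply: same_lhom2; exact: lsig_f1.
- move=> X Y f; rewrite -[X in _ =2c X]vcomp_1a; apply: same_vcomp.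
    apply: same_trans (same_lsig _ (lhom1_id F Y) erefl) (lsig_1f _ _).
  by rewrite -lhom2_id; apply: same_lhom2; exact: lsig_1f.
Defined.

Definition laxfun_of_functor (C D : category) (F : functor C D) :
  laxfun (locally_discrete C) (locally_discrete D).
Proof.
refine (@LaxFun (locally_discrete C) (locally_discrete D) F
  (fun X Y f => fhom F f) (fun X Y f g (a : f = g) => f_equal (fhom F) a)
  (fun X Y Z g f => fhomM F g f) _ _ _ (fhom1 F) _ _ _).
- by move=> *; rewrite /=; apply: Prop_irrelevance.
- by move=> *; rewrite /=; apply: Prop_irrelevance.
- by move=> *; rewrite /=; apply: Prop_irrelevance.
- by move=> *; apply: same_cell_of_eq; rewrite /= ccompA.
- by move=> *; apply: same_cell_of_eq; rewrite /= ccompf1.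
- by move=> *; apply: same_cell_of_eq; rewrite /= ccomp1f.
Defined.

Lemma laxfun_compA (A B C D : twocat) (H : laxfun C D) (G : laxfun B C)
    (F : laxfun A B) :
  laxfun_comp (laxfun_comp H G) F = laxfun_comp H (laxfun_comp G F).
Proof.
apply: laxfun_ext => // X Y Z g f /=.
by rewrite lhom2_vcomp vcompA.
Qed.

Lemma laxfun_comp_id (C : category) (B : twocat)
    (F : laxfun (locally_discrete C) B) :
  laxfun_comp F (laxfun_of_functor (functor_id C)) = F.
Proof.
case: F => o h1 h2 s p1 p2 p3 p4 p5 p6 p7; apply: laxfun_ext => /=.
  by move=> X Y f g a; congr h2; rewrite /=; apply: Prop_irrelevance.
by move=> X Y Z g f; rewrite p1 vcomp_a1.
Qed.

Lemma laxfun_of_functor_comp (C D E : category) (F' : functor D E)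
    (F : functor C D) :
  laxfun_of_functor (functor_comp F' F) =
  laxfun_comp (laxfun_of_functor F') (laxfun_of_functor F).
Proof. by apply: laxfun_ext => *; rewrite /=; apply: Prop_irrelevance. Qed.

Record monotone (m n : nat) := Monotone {
  mfun :> 'I_m.+1 -> 'I_n.+1;
  mfunP : {homo mfun : i j / (i <= j)%N}
}.

Lemma monotone_ext m n (a b : monotone m n) : a =1 b -> a = b.
Proof.
case: a b => [a pa] [b pb] /= /funext E; subst b.
by rewrite (Prop_irrelevance pa pb).
Qed.

Definition mono_id n : monotone n n := Monotone (fun i j (h : (i <= j)%N) => h).

Definition mono_comp m n p (b : monotone n p) (a : monotone m n) :
  monotone m p := Monotone (fun i j h => mfunP b (mfunP a h)).

Definition mono_const m n (i : 'I_n.+1) : monotone m n :=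
  Monotone (fun _ _ _ => leqnn i).

Definition ordinal_cat (n : nat) : category.
Proof.
refine (@Category 'I_n.+1 (fun i j => (i <= j)%N) (fun i => leqnn i)
  (fun i j k hjk hij => leq_trans hij hjk) _ _ _);
by move=> *; rewrite /=; apply: Prop_irrelevance.
Defined.

Definition functor_of_monotone m n (a : monotone m n) :
  functor (ordinal_cat m) (ordinal_cat n).
Proof.
refine (@Functor (ordinal_cat m) (ordinal_cat n) a (@mfunP m n a) _ _);
by move=> *; rewrite /=; apply: Prop_irrelevance.
Defined.

Lemma functor_of_mono_id n :
  functor_of_monotone (mono_id n) = functor_id (ordinal_cat n).
Proof. exact: functor_ext. Qed.

Lemma functor_of_mono_comp m n p (b : monotone n p) (a : monotone m n) :
  functor_of_monotone (mono_comp b a) =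
  functor_comp (functor_of_monotone b) (functor_of_monotone a).
Proof. exact: functor_ext. Qed.

Record sset := SSet {
  simplex :> nat -> Type;
  sact : forall m n, monotone m n -> simplex n -> simplex m;
  sact_id : forall n (x : simplex n), sact (mono_id n) x = x;
  sact_comp : forall m n p (b : monotone n p) (a : monotone m n) (x : simplex p),
    sact (mono_comp b a) x = sact a (sact b x)
}.
Arguments sact {s m n} a x.

Record smap (X Y : sset) := SMap {
  sfun :> forall n, X n -> Y n;
  sfun_nat : forall m n (a : monotone m n) (x : X n),
    sfun (sact a x) = sact a (sfun x)
}.
Arguments sfun {X Y} s {n} _.

Definition degenerate_edge (X : sset) (v : X 0) : X 1 :=
  sact (mono_const 1 (@ord0 0)) v.

Definition sset_prod (X Y : sset) : sset.
Proof.
refine (@SSet (fun n => X n * Y n)%type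
  (fun m n a p => (sact a p.1, sact a p.2)) _ _).
- by move=> n [x y]; rewrite /= !sact_id.
- by move=> m n p b a [x y]; rewrite /= !sact_comp.
Defined.

Definition std_simplex (k : nat) : sset.
Proof.
refine (@SSet (fun n => monotone n k) (fun m n a x => mono_comp x a) _ _).
- by move=> n x; apply: monotone_ext.
- by move=> m n p b a x; apply: monotone_ext.
Defined.

Definition nerve (C : category) : sset.
Proof.
refine (@SSet (fun n => functor (ordinal_cat n) C)
  (fun m n a x => functor_comp x (functor_of_monotone a)) _ _).
- by move=> n x; rewrite functor_of_mono_id functor_compf1.
- by move=> m n p b a x; rewrite functor_of_mono_comp functor_compA.
Defined.

Definition geometric_nerve (A : twocat) : sset.
Proof.
refine (@SSet (fun n => laxfun (locally_discrete (ordinal_cat n)) A)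
  (fun m n a x => laxfun_comp x (laxfun_of_functor (functor_of_monotone a))) _ _).
- by move=> n x; rewrite functor_of_mono_id laxfun_comp_id.
- move=> m n p b a x.
  by rewrite functor_of_mono_comp laxfun_of_functor_comp laxfun_compA.
Defined.

Definition generated_classes (X : Type) (R : X -> X -> Prop) : Type :=
  {S : X -> Prop | exists x, S = clos_refl_sym_trans X R x}.

Definition connected_components (C : category) : Type :=
  generated_classes (fun x y : C => inhabited (chom x y)).

Local Open Scope group_scope.

Record group_iso (G H : groupType) := GroupIso {
  iso_mor :> {multiplicative G -> H};
  iso_bij : bijective iso_mor
}.

Lemma group_iso_ext (G H : groupType) (f g : group_iso G H) : f =1 g -> f = g.
Proof.
case: f g => [f pf] [g pg] /= E.
have {}E : f = g.
  case: f g {pf pg} E => [f [[Mf]]] [g [[Mg]]] /= /funext E; subst g.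
  by rewrite (Prop_irrelevance Mf Mg).
by subst g; rewrite (Prop_irrelevance pf pg).
Qed.

Definition group_iso_id (G : groupType) : group_iso G G :=
  @GroupIso G G idfun 
    (@Bijective G G idfun idfun (fun=> erefl) (fun=> erefl)).

Definition group_iso_comp (G H L : groupType) (g : group_iso H L)
  (f : group_iso G H) : group_iso G L :=
  @GroupIso G L (g \o f) (bij_comp (iso_bij g) (iso_bij f)).

Section AUT.
Variables (I : Type) (K : I -> groupType).

Definition AUT_cell2 (A B : I) (f g : group_iso (K A) (K B)) : Type :=
  {a : K B | forall x, g x * a = a * f x}.

Lemma AUT_cell2_same (A B : I) (f g f' g' : group_iso (K A) (K B))
    (a : AUT_cell2 f g) (b : AUT_cell2 f' g') :
  f = f' -> g = g' -> sval a = sval b ->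
  same_cell (T := @AUT_cell2 A B) a b.
Proof.
move=> Ef Eg; subst; case: a b => [a pa] [b pb] /= E; subst b.
by rewrite (Prop_irrelevance pa pb).
Qed.

Lemma AUT_cell2_eq (A B : I) (f g : group_iso (K A) (K B))
  (a b : AUT_cell2 f g) : sval a = sval b -> a = b.
Proof. by move=> E; apply/same_eq/AUT_cell2_same. Qed.

Definition AUT_id2 (A B : I) (f : group_iso (K A) (K B)) : AUT_cell2 f f.
Proof. by exists 1 => x; rewrite mulg1 mul1g. Defined.

Definition AUT_vcomp (A B : I) (f g h : group_iso (K A) (K B))
  (b : AUT_cell2 g h) (a : AUT_cell2 f g) : AUT_cell2 f h.
Proof.
exists (sval b * sval a) => x.
by rewrite mulgA (svalP b) -!mulgA (svalP a).
Defined.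

Definition AUT_hcomp (A B C : I) (g k : group_iso (K B) (K C))
  (f h : group_iso (K A) (K B)) (b : AUT_cell2 g k) (a : AUT_cell2 f h) :
  AUT_cell2 (group_iso_comp g f) (group_iso_comp k h).
Proof.
exists (sval b * g (sval a)) => x /=.
by rewrite mulgA (svalP b) -!mulgA -!gmulfM (svalP a).
Defined.

Lemma gmulf1_iso (G H : groupType) (f : group_iso G H) : f 1 = 1.
Proof. by apply: (mulgI (f 1)); rewrite -gmulfM !mulg1. Qed.

(* The object K_A is represented by its index A. *)
Definition AUT : twocat.
Proof.
refine (@TwoCat I (fun A B => group_iso (K A) (K B)) AUT_cell2
  (fun A => group_iso_id (K A)) (fun A B C g f => group_iso_comp g f)
  AUT_id2 AUT_vcomp AUT_hcomp _ _ _ _ _ _ _ _ _ _ _).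
- by move=> *; apply: group_iso_ext.
- by move=> *; apply: group_iso_ext.
- by move=> *; apply: group_iso_ext.
- by move=> *; apply: AUT_cell2_eq; rewrite /= mulgA.
- by move=> *; apply: AUT_cell2_eq; rewrite /= mul1g.
- by move=> *; apply: AUT_cell2_eq; rewrite /= mulg1.
- by move=> *; apply: AUT_cell2_eq; rewrite /= gmulf1_iso mulg1.
- move=> A B C g g' g'' f f' f'' b' b a' a; apply: AUT_cell2_eq => /=.
  by rewrite gmulfM !mulgA -(mulgA _ (g' _)) (svalP b) !mulgA.
- move=> *; apply: AUT_cell2_same; [exact: group_iso_ext..|].
  by rewrite /= gmulfM mulgA.
- move=> *; apply: AUT_cell2_same; [exact: group_iso_ext..|].
  by rewrite /= mul1g.
- move=> *; apply: AUT_cell2_same; [exact: group_iso_ext..|].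
  by rewrite /= gmulf1_iso mulg1.
Defined.

End AUT.

Record weak_action (G : groupoid) (K : G -> groupType) := WeakAction {
  wact : forall A B : G, chom A B -> group_iso (K A) (K B);
  wcoc : forall A B C : G, chom B C -> chom A B -> K C;
  wact1 : forall (A : G) (x : K A), wact (cid A) x = x;
  wcoc1 : forall A : G, wcoc (cid A) (cid A) = 1;
  wactM : forall (A B C : G) (v : chom B C) (u : chom A B) (x : K A),
    wcoc v u * wact (ccomp v u) x = wact v (wact u x) * wcoc v u;
  wcocA : forall (A B C D : G) (w : chom C D) (v : chom B C) (u : chom A B),
    wcoc w v * wcoc (ccomp w v) u = wact w (wcoc v u) * wcoc w (ccomp v u)
}.
Arguments wact {G K} F {A B} u : rename.
Arguments wcoc {G K} F {A B C} v u : rename.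

Record weak_action_hom (G : groupoid) (K : G -> groupType)
    (F1 F2 : weak_action K) := WeakActionHom {
  wtau : forall A B : G, chom A B -> K B;
  wtau_nat : forall (A B : G) (u : chom A B) (k : K A),
    wtau u * wact F1 u k = wact F2 u k * wtau u;
  wtau1 : forall A : G, wtau (cid A) = 1;
  wtauM : forall (A B C : G) (v : chom B C) (u : chom A B),
    wact F2 v (wtau u) * wtau v * wcoc F1 v u = wcoc F2 v u * wtau (ccomp v u)
}.
Arguments wtau {G K F1 F2} t {A B} u : rename.

Lemma weak_action_hom_ext (G : groupoid) (K : G -> groupType)
    (F1 F2 : weak_action K) (s t : weak_action_hom F1 F2) :
  (forall (A B : G) (u : chom A B), wtau s u = wtau t u) -> s = t.
Proof.
case: s t => [s p1 p2 p3] [t q1 q2 q3] /= E.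
have {}E : s = t by do 3 (apply: functional_extensionality_dep => ?).
subst t; by rewrite (Prop_irrelevance p1 q1) (Prop_irrelevance p2 q2)
  (Prop_irrelevance p3 q3).
Qed.

Definition weak_action_hom_id (G : groupoid) (K : G -> groupType)
  (F : weak_action K) : weak_action_hom F F.
Proof.
exists (fun A B u => 1) => //.
- by move=> A B u k; rewrite mulg1 mul1g.
- by move=> A B C v u; rewrite gmulf1_iso !mul1g mulg1.
Defined.

Definition weak_action_hom_comp (G : groupoid) (K : G -> groupType)
  (F1 F2 F3 : weak_action K) (t : weak_action_hom F2 F3)
  (s : weak_action_hom F1 F2) : weak_action_hom F1 F3.
Proof.
exists (fun A B u => wtau t u * wtau s u).
- by move=> A B u k; rewrite -mulgA wtau_nat !mulgA wtau_nat.
- by move=> A; rewrite !wtau1 mulg1.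
- move=> A B C v u; rewrite gmulfM !mulgA -wtauM.
  rewrite -(mulgA _ _ (wtau t v)) -(wtau_nat t v (wtau s u)).
  by have := wtauM s v u; rewrite -!mulgA => ->.
Defined.

Definition weak_action_category (G : groupoid) (K : G -> groupType) : category.
Proof.
refine (@Category (weak_action K) (@weak_action_hom G K)
  (@weak_action_hom_id G K) (@weak_action_hom_comp G K) _ _ _).
- by move=> *; apply: weak_action_hom_ext => *; rewrite /= mulgA.
- by move=> *; apply: weak_action_hom_ext => *; rewrite /= mul1g.
- by move=> *; apply: weak_action_hom_ext => *; rewrite /= mulg1.
Defined.

Definition cohomology_H2 (G : groupoid) (K : G -> groupType) : Type :=
  connected_components (weak_action_category K).

Local Open Scope nat_scope.

Section NormalizedHomotopy.
Variables (G : groupoid) (K : G -> groupType).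

Let NerG : sset := nerve G.
Let NerAUT : sset := geometric_nerve (AUT K).

(* The star in Sset_*: as weak actions send each object A to K_A, the maps
   considered send the vertex A of Ner(G) to the vertex K_A of Ner(AUT(K)).
   (Normalized homotopies preserve vertices, so this selects whole classes;
   without it the bijection fails already for a discrete G with two objects.)
   Vertices are (lax) functors from [0]. *)
Definition over_objects (phi : smap NerG NerAUT) : Prop :=
  forall A : NerG 0, lob (phi 0 A) (@ord0 0) = A (@ord0 0).

Definition normalized_homotopy (phi psi : smap NerG NerAUT) : Prop :=
  exists h : smap (sset_prod NerG (std_simplex 1)) NerAUT,
    [/\ forall n (x : NerG n), h n (x, mono_const n (@ord0 1)) = phi n x,
        forall n (x : NerG n), h n (x, mono_const n (@ord_max 1)) = psi n x
      & forall A : NerG 0, exists v : NerAUT 0,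
          h 1 (degenerate_edge A, mono_id 1) = degenerate_edge v].

Definition Sset_star_classes : Type :=
  generated_classes (fun phi psi : {phi | over_objects phi} =>
    normalized_homotopy (sval phi) (sval psi)).

End NormalizedHomotopy.

(* Main.v *)
From Stdlib Require Import Relations.Relation_Operators.
From mathcomp Require Import boolp.
Require Import Defs.
From mathcomp Require Import all_boot.

Set Implicit Arguments.
Unset Strict Implicit.
Unset Printing Implicit Defensive.

(** The bijection is induced by sending a weak action [F] to the simplicial map
    that composes a simplex of Ner(G), a functor [n] -> G, with the lax functor
    F : G -> AUT(K).  Two facts carry the proof.

    The first is that the geometric nerve is full and faithful on lax functors
    out of a category: a simplicial map Ner(C) -> Ner(AUT(K)) is a lax functor
    C -> AUT(K).  Indeed it is determined by its values on 1-simplices (the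
    isomorphisms) and 2-simplices (the elements sigma), because every simplex
    of either nerve is determined by its faces of dimension at most 2, while
    the cocycle law is what its value on a 3-simplex expresses
    ([nerve_map_full], [nerve_map_inj]).  For C = G it shows that weak actions
    correspond exactly to the simplicial maps over the objects.

    The second is that a homotopy is a simplicial map on
    Ner(G) x Delta[1] = Ner(G x [1]), hence, by the first fact, a lax functor
    on the cylinder G x [1] that restricts to the two given weak actions at
    the ends; it is normalized when its isomorphisms over the vertical arrows
    A x (0 -> 1) are identities.  A morphism tau of weak actions gives such a
    lax functor ([cocycle_of_hom]).  Conversely the arrow (u, 0 -> 1) of the
    cylinder factors in two ways through a vertical arrow, so a lax functor on
    the cylinder provides two 2-cells with source its value at (u, 0 -> 1), and
    tau(u) is the first times the inverse of the second ([hom_of_cocycle]).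
    So normalized homotopies and morphisms of weak actions relate the same
    pairs, and both sides are classes for the same generated equivalence.

    The vertices of a simplicial map are only propositionally equal to the
    prescribed objects.  Lax functors into AUT(K) are therefore described by
    cocycles over a fixed object function o, with values in the groups
    K (o A), and equalities between cells over different object functions are
    compared together with their boundaries. *)

Local Open Scope group_scope.

(** * Cocycles on a category *)

Lemma gmulfV_iso (G H : groupType) (f : group_iso G H) x : f x^-1 = (f x)^-1.
Proof. by apply: (mulgI (f x)); rewrite -gmulfM !mulgV gmulf1_iso. Qed.

(** A weak action of an arbitrary category on a family of groups indexed by its
    objects: the ordinals [n] and the cylinder G x [1], which are not
    groupoids, need the notion as well. *)
Record cocycle (C : category) (L : C -> groupType) := Cocycle {
  cact : forall A B : C, chom A B -> group_iso (L A) (L B);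
  ccoc : forall A B D : C, chom B D -> chom A B -> L D;
  cact1 : forall (A : C) (x : L A), cact (cid A) x = x;
  ccoc1 : forall A : C, ccoc (cid A) (cid A) = 1;
  cactM : forall (A B D : C) (v : chom B D) (u : chom A B) (x : L A),
    ccoc v u * cact (ccomp v u) x = cact v (cact u x) * ccoc v u;
  ccocA : forall (A B D E : C) (w : chom D E) (v : chom B D) (u : chom A B),
    ccoc w v * ccoc (ccomp w v) u = cact w (ccoc v u) * ccoc w (ccomp v u)
}.
Arguments cact {C L} c {A B} u : rename.
Arguments ccoc {C L} c {A B D} v u : rename.

Lemma cocycle_ext (C : category) (L : C -> groupType) (c c' : cocycle L) :
  (forall (A B : C) (u : chom A B), cact c u = cact c' u) ->
  (forall (A B D : C) (v : chom B D) (u : chom A B),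
    ccoc c v u = ccoc c' v u) ->
  c = c'.
Proof.
case: c c' => [f s p1 p2 p3 p4] [f' s' q1 q2 q3 q4] /= Ef Es.
have {}Ef : f = f' by do 3 (apply: functional_extensionality_dep => ?).
have {}Es : s = s' by do 5 (apply: functional_extensionality_dep => ?).
subst f' s'.
by rewrite (Prop_irrelevance p1 q1) (Prop_irrelevance p2 q2)
  (Prop_irrelevance p3 q3) (Prop_irrelevance p4 q4).
Qed.

Definition pullback (D C : category) (L : C -> groupType) (x : functor D C)
  (c : cocycle L) : cocycle (fun A => L (x A)).
Proof.
exists (fun A B u => cact c (fhom x u))
  (fun A B E v u => ccoc c (fhom x v) (fhom x u)).
- by move=> A k; rewrite fhom1 cact1.
- by move=> A; rewrite fhom1 ccoc1.
- by move=> A B E v u k; rewrite fhomM cactM.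
- by move=> A B E H w v u; rewrite !fhomM ccocA.
Defined.

Lemma pullback_comp (E D C : category) (L : C -> groupType) (x : functor D C)
    (y : functor E D) (c : cocycle L) :
  pullback (functor_comp x y) c = pullback y (pullback x c).
Proof. exact: cocycle_ext. Qed.

(** The cocycle law at (u, 1, 1) reads s s = F(u)(1) s for s = sigma_(u,1), so
    the normalization at identities forces the one at every arrow. *)
Lemma ccoc_f1 (C : category) (L : C -> groupType) (c : cocycle L)
  (A B : C) (u : chom A B) : ccoc c u (cid A) = 1.
Proof.
have := ccocA c u (cid A) (cid A).
by rewrite ccoc1 gmulf1_iso !ccompf1 mul1g -[RHS]mul1g => /mulIg.
Qed.

Lemma ccoc_1f (C : category) (L : C -> groupType) (c : cocycle L)
  (A B : C) (u : chom A B) : ccoc c (cid B) u = 1.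
Proof.
have := ccocA c (cid B) (cid B) u.
by rewrite ccoc1 cact1 !ccomp1f => /mulIg.
Qed.

Definition cocycle_of_weak_action (G : groupoid) (K : G -> groupType)
    (F : weak_action K) : cocycle K :=
  Cocycle (wact1 F) (wcoc1 F) (wactM F) (wcocA F).

Definition weak_action_of_cocycle (G : groupoid) (K : G -> groupType)
    (c : cocycle K) : weak_action K :=
  WeakAction (cact1 c) (ccoc1 c) (cactM c) (ccocA c).

(** * Cocycles are lax functors into AUT(K) *)

Section CocyclesAsLaxFunctors.
Variables (I : Type) (K : I -> groupType) (C : category).

Definition coc_cell (o : C -> I) (c : cocycle (fun A => K (o A))) (A B D : C)
    (v : chom B D) (u : chom A B) :
  AUT_cell2 (K := K) (cact c (ccomp v u))
    (group_iso_comp (cact c v) (cact c u)).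
Proof. by exists (ccoc c v u) => x; rewrite cactM. Defined.

Definition eq_cell (o : C -> I) (c : cocycle (fun A => K (o A))) (A B : C)
    (u v : chom A B) (e : u = v) :
  AUT_cell2 (K := K) (cact c u) (cact c v).
Proof. by exists 1 => x; rewrite e mulg1 mul1g. Defined.

Definition lax_of_cocycle (o : C -> I) (c : cocycle (fun A => K (o A))) :
  laxfun (locally_discrete C) (AUT K).
Proof.
refine (@LaxFun (locally_discrete C) (AUT K) o (fun A B u => cact c u)
  (fun A B f g e => eq_cell c e) (fun A B D v u => coc_cell c v u)
  _ _ _ _ _ _ _).
- by move=> A B f; apply: AUT_cell2_eq.
- by move=> *; apply: AUT_cell2_eq; rewrite /= mulg1.
- move=> A B D g g' f f' b a; apply: AUT_cell2_eq => /=.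
  by case: _ / b; case: _ / a; rewrite gmulf1_iso !mulg1 mul1g.
- by move=> A; apply: group_iso_ext => x; rewrite cact1.
- move=> A B D E h g f; apply: AUT_cell2_same => /=.
  + by rewrite ccompA.
  + exact: group_iso_ext.
  + by rewrite gmulf1_iso mulg1 mul1g ccocA.
- move=> A B f; apply: AUT_cell2_same => /=.
  + by rewrite ccompf1.
  + by apply: group_iso_ext => x /=; rewrite cact1.
  + exact: ccoc_f1.
- move=> A B f; apply: AUT_cell2_same => /=.
  + by rewrite ccomp1f.
  + by apply: group_iso_ext => x /=; rewrite cact1.
  + exact: ccoc_1f.
Defined.

(** The components of a lax functor packed with their boundaries: an equality
    of lax functors, whose object functions are not convertible in general, can
    be projected through [total1] and [total2]. *)
Definition total1 (X : laxfun (locally_discrete C) (AUT K)) (A B : C)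
    (u : chom A B) :=
  with_boundary (T := fun A B => group_iso (K A) (K B)) (lhom1 X u).

Definition total2 (X : laxfun (locally_discrete C) (AUT K)) (A B D : C)
    (v : chom B D) (u : chom A B) :=
  with_boundary (T := fun _ D => K D) (x := X A) (sval (lsig X v u)).

Arguments lax_of_cocycle : clear implicits.

Lemma lax_of_cocycle_inj (o : C -> I) (c c' : cocycle (fun A => K (o A))) :
  lax_of_cocycle o c = lax_of_cocycle o c' -> c = c'.
Proof.
move=> E; apply: cocycle_ext => *.
  exact: same_eq (f_equal (fun X => total1 X _) E).
exact: same_eq (f_equal (fun X => total2 X _ _) E).
Qed.

(** The object function [o] may be any one that agrees pointwise with that of
    [X]; this is where the propositional equality of vertices is absorbed. *)
Lemma lax_of_cocycle_surj (X : laxfun (locally_discrete C) (AUT K))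
    (o : C -> I) :
  (forall A, X A = o A) ->
  exists c : cocycle (fun A => K (o A)), X = lax_of_cocycle o c.
Proof.
move=> Eo; have {Eo} E := functional_extensionality_dep Eo; case: _ / E.
unshelve refine (let c : cocycle (fun A => K (X A)) :=
  @Cocycle C (fun A => K (X A)) (fun A B u => lhom1 X u)
    (fun A B D v u => sval (lsig X v u)) _ _ _ _ in _).
- by move=> A x; rewrite (lhom1_id X A).
- move=> A; apply: (same_ind (P := fun _ _ a => sval a = 1)
    (same_sym (lsig_f1 X (id1 (A : locally_discrete C))))).
  by [].
- by move=> A B D v u x; rewrite (svalP (lsig X v u)).
- move=> A B D E w v u; have := lsigA X w v u.
  set a := vcomp _ _; set b := vcomp _ _ => E0.
  have := same_ind (P := fun _ _ c => sval c = sval b) (same_sym E0) erefl.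
  by rewrite /a /b /= gmulf1_iso mulg1 mul1g.
exists c; case: X @c => ob h1 h2 s p1 p2 p3 p4 p5 p6 p7 c.
apply: laxfun_ext.
  by move=> A B f g e; case: _ / e; rewrite [LHS]p1; apply: AUT_cell2_eq.
by move=> *; apply: AUT_cell2_eq.
Qed.

End CocyclesAsLaxFunctors.

Arguments lax_of_cocycle {I} K {C} o c.

Lemma lax_of_pullback (I : Type) (K : I -> groupType) (C D : category)
    (x : functor D C) (o : C -> I)
    (c : cocycle (fun A => K (o A))) :
  laxfun_comp (lax_of_cocycle K o c) (laxfun_of_functor x) =
  lax_of_cocycle K (o \o x) (pullback x c).
Proof.
by apply: laxfun_ext => *; apply: AUT_cell2_eq; rewrite /= ?mulg1.
Qed.


(** * Simplicial maps between nerves *)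

Definition nerve_map (I : Type) (K : I -> groupType) (C : category)
    (o : C -> I) (c : cocycle (fun A => K (o A))) :
  smap (nerve C) (geometric_nerve (AUT K)).
Proof.
exists (fun n (x : nerve C n) => lax_of_cocycle K (o \o x) (pullback x c))
  => m n a x.
by rewrite [RHS]lax_of_pullback -pullback_comp.
Defined.

Arguments nerve_map {I} K {C} o c.

Lemma smap_ext (X Y : sset) (f g : smap X Y) :
  (forall n, @sfun _ _ f n =1 g n) -> f = g.
Proof.
case: f g => [f p] [g q] /= E.
have {}E : f = g by do 2 (apply: functional_extensionality_dep => ?); exact: E.
by subst g; rewrite (Prop_irrelevance p q).
Qed.

(** Unlike [functor_ext], this compares functors whose object functions are
    not convertible; the agreement on objects is that of the boundaries of the
    identities. *)
Lemma functor_same (D C : category) (F F' : functor D C) :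
  (forall A B (u : chom A B),
    same_cell (T := @chom C) (fhom F u) (fhom F' u)) ->
  F = F'.
Proof.
case: F F' => [o h p q] [o' h' p' q'] /= E.
have Eo : o = o'.
  apply: functional_extensionality_dep => A.
  exact: (same_ind (P := fun B _ _ => o A = B) (E A A (cid A)) erefl).
subst o'; apply: functor_ext => A B u; exact: same_eq (E A B u).
Qed.

Lemma ord_hom_irr n (i j : ordinal_cat n) (p q : chom i j) : p = q.
Proof. exact: bool_irrelevance. Qed.

Section Chains.
Variable C : category.

Section Chain.
Variables (A B D E : C) (u : chom A B) (v : chom B D) (w : chom D E).

(** The branch [_] stands for the vertex 3, here and in [chain_hom]; the last
    branch of [chain_hom] collects the pairs with j < i. *)
Definition chain_ob (i : nat) : C :=
  match i with 0 => A | 1 => B | 2 => D | _ => E end.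

Definition chain_hom (i j : nat) :
  (i <= j)%N -> chom (chain_ob i) (chain_ob j) :=
  match i, j return (i <= j)%N -> chom (chain_ob i) (chain_ob j) with
  | 0, 0 => fun=> cid A
  | 0, 1 => fun=> u
  | 0, 2 => fun=> ccomp v u
  | 0, _ => fun=> ccomp w (ccomp v u)
  | 1, 1 => fun=> cid B
  | 1, 2 => fun=> v
  | 1, _.+3 => fun=> ccomp w v
  | 2, 2 => fun=> cid D
  | 2, _.+3 => fun=> w
  | _.+3, _.+3 => fun=> cid E
  | _, _ => fun h => False_rect _ (notF h)
  end.

(** The 3-simplex with spine (u, v, w).  Its vertices compute to A, B, D, E, so
    that the values of a simplicial map on it have the expected types without
    transport.  The same construction serves for edges and triangles, with
    identities filling up the spine. *)
Definition chain3 : functor (ordinal_cat 3) C.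
Proof.
refine (@Functor (ordinal_cat 3) C (fun i => chain_ob (nat_of_ord i))
  (fun i j h => chain_hom h) _ _).
- by case=> [[|[|[|i]]] hi].
- case=> [i hi] [j hj] [k hk] g f /=; case: g f => /=; move: hi hj hk.
  by case: i => [|[|[|i]]]; case: j => [|[|[|j]]]; case: k => [|[|[|k]]];
    rewrite //= ?ccomp1f ?ccompf1 ?ccompA.
Defined.

End Chain.

Definition v0 : ordinal_cat 3 := @Ordinal 4 0 isT.
Definition v1 : ordinal_cat 3 := @Ordinal 4 1 isT.
Definition v2 : ordinal_cat 3 := @Ordinal 4 2 isT.
Definition v3 : ordinal_cat 3 := @Ordinal 4 3 isT.
Definition e01 : chom v0 v1 := isT.
Definition e12 : chom v1 v2 := isT.
Definition e23 : chom v2 v3 := isT.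

(** A simplex of the nerve of a category is determined by its spine. *)
Lemma chain3P (y : functor (ordinal_cat 3) C) (u : chom (y v0) (y v1))
    (v : chom (y v1) (y v2)) (w : chom (y v2) (y v3)) :
  fhom y e01 = u -> fhom y e12 = v -> fhom y e23 = w -> y = chain3 u v w.
Proof.
move=> <- <- <-; apply: functor_same => -[i hi] [j hj] f.
case: i hi f => [|[|[|[|i]]]] hi f //; rewrite (bool_irrelevance hi isT) in f *;
case: j hj f => [|[|[|[|j]]]] hj f //; rewrite (bool_irrelevance hj isT) in f *.
- by rewrite (ord_hom_irr f (cid _)) !fhom1.
- by rewrite (ord_hom_irr f e01).
- by rewrite (ord_hom_irr f (ccomp e12 e01)) fhomM.
- by rewrite (ord_hom_irr f (ccomp e23 (ccomp e12 e01))) !fhomM.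
- by rewrite (ord_hom_irr f (cid _)) !fhom1.
- by rewrite (ord_hom_irr f e12).
- by rewrite (ord_hom_irr f (ccomp e23 e12)) fhomM.
- by rewrite (ord_hom_irr f (cid _)) !fhom1.
- by rewrite (ord_hom_irr f e23).
- by rewrite (ord_hom_irr f (cid _)) !fhom1.
Qed.

End Chains.

Definition const_functor (D C : category) (A : C) : functor D C.
Proof.
by exists (fun=> A) (fun _ _ _ => cid A) => // *; rewrite ccomp1f.
Defined.

Definition vertex (C : category) (A : C) : functor (ordinal_cat 0) C :=
  const_functor (ordinal_cat 0) A.

Definition pick4 n (i j k l : 'I_n.+1) (t : 'I_4) : 'I_n.+1 :=
  match nat_of_ord t with 0 => i | 1 => j | 2 => k | _ => l end.

Definition face4 n (i j k l : 'I_n.+1) (ij : (i <= j)%N) (jk : (j <= k)%N)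
  (kl : (k <= l)%N) : monotone 3 n.
Proof.
exists (pick4 i j k l) => -[[|[|[|s]]] hs] [[|[|[|t]]] ht] //= _;
  rewrite /pick4 //=.
- exact: leq_trans ij jk.
- exact: leq_trans (leq_trans ij jk) kl.
- exact: leq_trans jk kl.
Defined.

(** A simplicial map [phi] restricts on each simplex [x] to a cocycle
    [cocycle_at x] on [n].  Naturality makes its components at an arrow or a
    composable pair of [n] depend only on the images of these under [x], so
    they come from components on C. *)
Section NerveFull.
Variables (I : Type) (K : I -> groupType) (C : category) (o : C -> I).
Variable phi : smap (nerve C) (geometric_nerve (AUT K)).
Hypothesis phi_o : forall A : C, lob (phi 0 (vertex A)) ord0 = o A.

Lemma lob_nerve n (x : nerve C n) (i : 'I_n.+1) :
  lob (phi n x) i = o (fob x i).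
Proof.
rewrite -phi_o; have -> : vertex (fob x i) = sact (mono_const 0 i) x.
  apply: functor_ext => s t f.
  by rewrite -(fhom1 x); congr (fhom x); apply: ord_hom_irr.
by rewrite sfun_nat.
Qed.

Definition simplex_cocycle n (x : nerve C n) :
    {c : cocycle (fun i => K (o (fob x i))) |
      phi n x = lax_of_cocycle K (o \o fob x) c} :=
  boolp.cid (@lax_of_cocycle_surj I K (ordinal_cat n) (phi n x)
    (o \o fob x) (lob_nerve x)).

Definition cocycle_at n (x : nerve C n) : cocycle (fun i => K (o (fob x i))) :=
  sval (simplex_cocycle x).

Lemma cocycle_atE n (x : nerve C n) :
  phi n x = lax_of_cocycle K (o \o fob x) (cocycle_at x).
Proof. exact: svalP (simplex_cocycle x). Qed.

Lemma cocycle_at_nat m n (a : monotone m n) (x : nerve C n) :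
  cocycle_at (sact a x) = pullback (functor_of_monotone a) (cocycle_at x).
Proof.
have := cocycle_atE (sact a x); rewrite sfun_nat (cocycle_atE x) => E.
apply: (@lax_of_cocycle_inj I K (ordinal_cat m) (o \o fob x \o a)).
exact: eq_trans (esym E) (@lax_of_pullback I K _ _
  (functor_of_monotone a) (o \o fob x) (cocycle_at x)).
Qed.

Definition nerve_act A B (u : chom A B) : group_iso (K (o A)) (K (o B)) :=
  cact (cocycle_at (chain3 u (cid B) (cid B) : nerve C 3)) e01.

Definition nerve_coc A B D (v : chom B D) (u : chom A B) : K (o D) :=
  ccoc (cocycle_at (chain3 u v (cid D) : nerve C 3)) e12 e01.

(** The arrow h : i -> j of [n] is the first edge of the degenerate 3-simplex
    (i, j, j, j), which [x] maps to the chain of x(h) and two identities. *)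
Lemma nerve_actE n (x : nerve C n) (i j : ordinal_cat n) (h : chom i j) :
  cact (cocycle_at x) h = nerve_act (fhom x h).
Proof.
pose a := face4 h (leqnn j) (leqnn j).
have E : sact a x = chain3 (fhom x h) (cid (x j)) (cid (x j)).
  apply: chain3P.
  - by congr (fhom x); apply: ord_hom_irr.
  - by rewrite -(fhom1 x); congr (fhom x); apply: ord_hom_irr.
  - by rewrite -(fhom1 x); congr (fhom x); apply: ord_hom_irr.
have -> : cact (cocycle_at x) h = cact (cocycle_at (sact a x)) e01.
  by rewrite cocycle_at_nat /=; congr cact; apply: ord_hom_irr.
apply: (@same_eq I (fun A B => group_iso (K A) (K B))).
exact: (f_equal (fun y : nerve C 3 => with_boundary
  (T := fun A B => group_iso (K A) (K B)) (cact (cocycle_at y) e01)) E).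
Qed.

Lemma nerve_cocE n (x : nerve C n) (i j k : ordinal_cat n) (g : chom j k)
    (h : chom i j) :
  ccoc (cocycle_at x) g h = nerve_coc (fhom x g) (fhom x h).
Proof.
pose a := face4 h g (leqnn k).
have E : sact a x = chain3 (fhom x h) (fhom x g) (cid (x k)).
  apply: chain3P.
  - by congr (fhom x); apply: ord_hom_irr.
  - by congr (fhom x); apply: ord_hom_irr.
  - by rewrite -(fhom1 x); congr (fhom x); apply: ord_hom_irr.
have -> : ccoc (cocycle_at x) g h = ccoc (cocycle_at (sact a x)) e12 e01.
  by rewrite cocycle_at_nat /=; congr ccoc; apply: ord_hom_irr.
apply: (@same_eq I (fun A B => K B) (o (x i)) (o (x k))).
exact: (f_equal (fun y : nerve C 3 => with_boundary
  (T := fun A B => K B) (x := o (fob y v0)) (ccoc (cocycle_at y) e12 e01)) E).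
Qed.

(** Each law is the corresponding law of the cocycle at a simplex that contains
    the arrows involved: a vertex for the normalization, a chain of two or three
    arrows for the others. *)
Definition nerve_cocycle : cocycle (fun A => K (o A)).
Proof.
exists nerve_act nerve_coc.
- move=> A x.
  rewrite -[LHS]/(nerve_act (fhom (vertex A) (cid (ord0 : ordinal_cat 0))) x).
  by rewrite -(@nerve_actE 0 (vertex A)) cact1.
- move=> A; pose i : ordinal_cat 0 := ord0.
  pose u := fhom (vertex A) (cid i); rewrite -[LHS]/(nerve_coc u u).
  by rewrite -(@nerve_cocE 0 (vertex A)) ccoc1.
- move=> A B D v u x.
  have := cactM (cocycle_at (chain3 u v (cid D) : nerve C 3)) e12 e01 x.
  by rewrite !nerve_actE nerve_cocE.
- move=> A B D E w v u.
  have := ccocA (cocycle_at (chain3 u v w : nerve C 3)) e23 e12 e01.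
  by rewrite nerve_actE !nerve_cocE.
Defined.

Lemma nerve_map_full : phi = nerve_map K o nerve_cocycle.
Proof.
apply: smap_ext => n x; rewrite cocycle_atE /=; congr lax_of_cocycle.
by apply: cocycle_ext => *; rewrite ?nerve_actE ?nerve_cocE.
Qed.

End NerveFull.

Lemma nerve_map_inj (I : Type) (K : I -> groupType) (C : category) (o : C -> I)
    (c c' : cocycle (fun A => K (o A))) :
  nerve_map K o c = nerve_map K o c' -> c = c'.
Proof.
move=> E; have Ex (x : nerve C 3) : pullback x c = pullback x c'.
  apply: (@lax_of_cocycle_inj I K (ordinal_cat 3) (o \o fob x)).
  exact: (f_equal (fun phi => sfun phi x) E).
apply: cocycle_ext => [A B u | A B D v u].
  exact: (f_equal (fun d => cact d e01) (Ex (chain3 u (cid B) (cid B)))).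
exact: (f_equal (fun d => ccoc d e12 e01) (Ex (chain3 u v (cid D)))).
Qed.

(** * Homotopies and the cylinder *)

Definition cylinder (C : category) : category.
Proof.
refine (@Category (C * ordinal_cat 1)%type
  (fun X Y => chom X.1 Y.1 * chom X.2 Y.2)%type (fun X => (cid X.1, cid X.2))
  (fun X Y Z g f => (ccomp g.1 f.1, ccomp g.2 f.2)) _ _ _).
- by move=> *; rewrite !ccompA.
- by move=> X Y [f h]; rewrite !ccomp1f.
- by move=> X Y [f h]; rewrite !ccompf1.
Defined.

Lemma cyl_hom_eq (C : category) (X Y : cylinder C) (f g : chom X Y) :
  f.1 = g.1 -> f = g.
Proof. by case: f g => [f h] [g k] /= ->; rewrite (ord_hom_irr h k). Qed.

Definition cyl_pair (D C : category) (x : functor D C)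
  (m : functor D (ordinal_cat 1)) : functor D (cylinder C).
Proof.
exists (fun d => (x d, m d) : cylinder C) (fun _ _ u => (fhom x u, fhom m u)).
- by move=> d; rewrite !fhom1.
- by move=> *; rewrite !fhomM.
Defined.

Definition cyl_base (C : category) : functor (cylinder C) C.
Proof. by exists fst (fun _ _ u => u.1). Defined.

Definition cyl_height (C : category) : functor (cylinder C) (ordinal_cat 1).
Proof. by exists snd (fun _ _ u => u.2). Defined.

Definition cyl_end (C : category) (i : ordinal_cat 1) :
    functor C (cylinder C) :=
  cyl_pair (functor_id C) (const_functor C i).

Definition monotone_of_functor n (f : functor (ordinal_cat n) (ordinal_cat 1)) :
    monotone n 1 :=
  Monotone (fun i j h => fhom f (h : chom (c := ordinal_cat n) i j)).

(** Ner(C x [1]) and Ner(C) x Delta[1] have the same simplices, so maps out of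
    one are maps out of the other. *)
Section Homotopy.
Variables (C : category) (Y : sset).

Definition homotopy_of_cyl (h : smap (nerve (cylinder C)) Y) :
  smap (sset_prod (nerve C) (std_simplex 1)) Y.
Proof.
exists (fun n x => h n (cyl_pair x.1 (functor_of_monotone x.2))) => m n a x.
by rewrite -sfun_nat; congr (h m _); apply: functor_ext.
Defined.

Definition cyl_of_homotopy (h : smap (sset_prod (nerve C) (std_simplex 1)) Y) :
  smap (nerve (cylinder C)) Y.
Proof.
exists (fun n x => h n (functor_comp (cyl_base C) x,
  monotone_of_functor (functor_comp (cyl_height C) x))) => m n a x.
rewrite -sfun_nat; congr (h m (_, _)).
exact: (esym (functor_compA _ _ _)).
Defined.

Lemma cyl_of_homotopyE (h : smap (sset_prod (nerve C) (std_simplex 1)) Y) n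
    (x : nerve C n) (m : std_simplex 1 n) :
  cyl_of_homotopy h n (cyl_pair x (functor_of_monotone m)) = h n (x, m).
Proof.
congr (h n (_, _)); last exact: monotone_ext.
by case: x => *; apply: functor_ext.
Qed.

End Homotopy.

Section HomCylinder.
Variables (G : groupoid) (K : G -> groupType) (F1 F2 : weak_action K).
Variable t : weak_action_hom F1 F2.

(** The isomorphism over (u, i <= j) is F1(u) or F2(u) according to the source
    level i alone, so it is the identity over a vertical arrow.  Then tau
    enters the 2-cells exactly when u climbs from level 0 to level 1, where
    the 2-cell required is F1(vu) -> F1(v) F1(u) -> F2(v) F1(u), the second
    step being given by tau(v). *)
Definition hom_act (X Y : cylinder G) (u : chom X Y) :
  group_iso (K X.1) (K Y.1) :=
  if nat_of_ord X.2 is 0 then wact F1 u.1 else wact F2 u.1.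

Definition hom_coc (X Y Z : cylinder G) (v : chom Y Z) (u : chom X Y) : K Z.1 :=
  if nat_of_ord X.2 is 0 then
    (if nat_of_ord Y.2 is 0 then 1 else wtau t v.1) * wcoc F1 v.1 u.1
  else wcoc F2 v.1 u.1.

Definition cocycle_of_hom : cocycle (fun X : cylinder G => K X.1).
Proof.
exists hom_act hom_coc; rewrite /hom_act /hom_coc.
- by move=> [A [[|i] hi]] x /=; rewrite wact1.
- by move=> [A [[|i] hi]] /=; rewrite wcoc1 ?mulg1.
- move=> [A [[|i] hi]] [B [[|j] hj]] [D k] [v jk] [u ij] x //=.
  + by rewrite !mul1g wactM.
  + by rewrite -mulgA wactM !mulgA wtau_nat.
  + by rewrite wactM.
- move=> [A [[|i] hi]] [B [[|j] hj]] [D [[|k] hk]] [E l]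
    [w kl] [v jk] [u ij] //=.
  + by rewrite !mul1g wcocA.
  + by rewrite !mul1g -mulgA wcocA !mulgA wtau_nat.
  + rewrite gmulfM mulgA -wtauM -!mulgA wcocA.
    by rewrite [in LHS](mulgA (wtau t w)) wtau_nat !mulgA.
  + by rewrite wcocA.
Defined.

End HomCylinder.

Section CylinderHom.
Variables (G : groupoid) (K : G -> groupType) (F1 F2 : weak_action K).
Variable c : cocycle (fun X : cylinder G => K X.1).

Definition bot : ordinal_cat 1 := ord0.
Definition top : ordinal_cat 1 := ord_max.
Definition bt : chom bot top := isT.
Hypothesis c_bot : pullback (cyl_end G bot) c = cocycle_of_weak_action F1.
Hypothesis c_top : pullback (cyl_end G top) c = cocycle_of_weak_action F2.
Hypothesis c_vert : forall A (x : K A),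
  cact (A := (A, bot) : cylinder G) (B := (A, top) : cylinder G) c (cid A, bt) x
  = x.

Let at_ (A : G) (i : ordinal_cat 1) : cylinder G := (A, i).
Let lo A B (u : chom A B) : chom (at_ A bot) (at_ B bot) := (u, cid bot).
Let hi A B (u : chom A B) : chom (at_ A top) (at_ B top) := (u, cid top).
Let up A : chom (at_ A bot) (at_ A top) := (cid A, bt).
Let diag A B (u : chom A B) : chom (at_ A bot) (at_ B top) := (u, bt).

Lemma act_lo A B (u : chom A B) : cact c (lo u) = wact F1 u.
Proof. exact: (f_equal (fun d => cact d u) c_bot). Qed.

Lemma act_hi A B (u : chom A B) : cact c (hi u) = wact F2 u.
Proof. exact: (f_equal (fun d => cact d u) c_top). Qed.

Lemma coc_lo A B D (v : chom B D) (u : chom A B) :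
  ccoc c (lo v) (lo u) = wcoc F1 v u.
Proof. exact: (f_equal (fun d => ccoc d v u) c_bot). Qed.

Lemma coc_hi A B D (v : chom B D) (u : chom A B) :
  ccoc c (hi v) (hi u) = wcoc F2 v u.
Proof. exact: (f_equal (fun d => ccoc d v u) c_top). Qed.

Lemma hi_up A B (u : chom A B) : ccomp (hi u) (up A) = diag u.
Proof. exact/cyl_hom_eq/ccompf1. Qed.

Lemma up_lo A B (u : chom A B) : ccomp (up B) (lo u) = diag u.
Proof. exact/cyl_hom_eq/ccomp1f. Qed.

Lemma hi_hi A B D (v : chom B D) (u : chom A B) :
  ccomp (hi v) (hi u) = hi (ccomp v u).
Proof. exact: cyl_hom_eq. Qed.

Lemma lo_lo A B D (v : chom B D) (u : chom A B) :
  ccomp (lo v) (lo u) = lo (ccomp v u).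
Proof. exact: cyl_hom_eq. Qed.

(** The two factors are the 2-cells from the value at (u, 0 -> 1) to F2(u) and
    to F1(u) respectively. *)
Definition cyl_tau A B (u : chom A B) : K B :=
  ccoc c (hi u) (up A) * (ccoc c (up B) (lo u))^-1.

Lemma hom_of_cocycle : weak_action_hom F1 F2.
Proof.
exists cyl_tau; rewrite /cyl_tau.
- move=> A B u k.
  have := cactM c (up B) (lo u) k; have := cactM c (hi u) (up A) k.
  rewrite hi_up up_lo act_lo act_hi !c_vert => Ea Eb.
  rewrite mulgA -Ea -!mulgA; congr (_ * _).
  by apply: (mulgI (ccoc c (up B) (lo u))); rewrite !mulgA mulgV mul1g Eb mulgK.
- move=> A.
  have : hi (cid A) = cid (at_ A top) by [].
  have : lo (cid A) = cid (at_ A bot) by [].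
  by move=> -> ->; rewrite ccoc_f1 ccoc_1f mul1g invg1.
- move=> A B D v u.
  (* The three chains of the cylinder over (u, v): the vertical step comes
     first, between u and v, and last. *)
  have E1 := ccocA c (hi v) (hi u) (up A).
  have E2 := ccocA c (hi v) (up B) (lo u).
  have E3 := ccocA c (up D) (lo v) (lo u).
  rewrite hi_hi hi_up act_hi coc_hi in E1.
  rewrite up_lo hi_up act_hi in E2.
  rewrite up_lo lo_lo coc_lo c_vert in E3.
  apply: (mulIg (ccoc c (up D) (lo (ccomp v u)))).
  by rewrite gmulfM gmulfV_iso -!mulgA mulVg mulg1 -E3 mulKg E1 E2 mulKg.
Qed.

End CylinderHom.

(** * Classes for generated equivalences *)

Section GeneratedClasses.
Variables (X Y : Type) (R : X -> X -> Prop) (S : Y -> Y -> Prop) (f : X -> Y).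
Hypothesis f_surj : forall y, exists x, f x = y.
Hypothesis R_refl : forall x, R x x.
Hypothesis RS : forall x x', R x x' <-> S (f x) (f x').

Lemma clos_surj_iff x x' :
  clos_refl_sym_trans X R x x' <-> clos_refl_sym_trans Y S (f x) (f x').
Proof.
split.
  elim=> [a b /RS | a | a b _ | a b d _ H1 _ H2].
  - exact: rst_step.
  - exact: rst_refl.
  - exact: rst_sym.
  - exact: rst_trans H1 H2.
move: {-1}(f x) {-1}(f x') (erefl (f x)) (erefl (f x')) => y y' Ey Ey' H.
elim: H x x' Ey Ey' => {y y'}
  [y y' Syy' | y | y y' _ IH | y y' y'' _ IH _ IH'] x x' Ex Ex'.
- by apply/rst_step/RS; rewrite Ex Ex'.
(* Two elements with the same image are related, because S relates that image
   to itself. *)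
- by apply/rst_step/RS; rewrite Ex' -Ex; apply/RS.
- by apply/rst_sym/IH.
- have [z Ez] := f_surj y'; exact: rst_trans (IH _ _ Ex Ez) (IH' _ _ Ez Ex').
Qed.

Lemma generated_classes_bij :
  exists F : generated_classes R -> generated_classes S, bijective F.
Proof.
have im (P : generated_classes R) :
    exists y0, (fun y => exists2 x, f x = y & sval P x) =
      clos_refl_sym_trans Y S y0.
  case: P => P [x0 E]; subst P; exists (f x0).
  apply/funext => y; apply/propext; split.
    by move=> [x <- /clos_surj_iff].
  by have [x <-] := f_surj y; move=> /clos_surj_iff; exists x.
have pre (Q : generated_classes S) :
    exists x0, (fun x => sval Q (f x)) = clos_refl_sym_trans X R x0.
  case: Q => Q [y0 E]; subst Q; have [x0 <-] := f_surj y0; exists x0.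
  by apply/funext => x; apply/propext; split=> /clos_surj_iff.
have class_ext Z (T : Z -> Z -> Prop) (P Q : generated_classes T) :
  sval P = sval Q -> P = Q by case: P Q => P hP [Q hQ] /= E; exact: eq_exist.
pose F P : generated_classes S := exist (fun T => exists y, T = _) _ (im P).
pose F' Q : generated_classes R := exist (fun T => exists x, T = _) _ (pre Q).
exists F, F' => [P|Q]; apply: class_ext => /=; apply/funext => z; apply/propext.
- case: P => P [x0 E]; subst P => /=; split=> [[x Ex] | Pz]; last by exists z.
  by move=> /clos_surj_iff; rewrite Ex => /clos_surj_iff.
- by split=> [[x <-] | Qz] //; have [x Ex] := f_surj z; exists x; rewrite ?Ex.
Qed.

End GeneratedClasses.

(** * Weak actions as simplicial maps *)

Section MapsOfWeakActions.
Variables (G : groupoid) (K : G -> groupType).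

Definition smap_of_weak_action (F : weak_action K) :
  smap (nerve G) (geometric_nerve (AUT K)) :=
  nerve_map K id (cocycle_of_weak_action F).

Lemma smap_of_weak_action_over (F : weak_action K) :
  over_objects (smap_of_weak_action F).
Proof. by []. Qed.

Lemma smap_of_weak_action_surj
    (phi : smap (nerve G) (geometric_nerve (AUT K))) :
  over_objects phi -> exists F, smap_of_weak_action F = phi.
Proof.
move=> phiP; have phi_id A : lob (phi 0 (vertex A)) ord0 = A by exact: phiP.
exists (weak_action_of_cocycle (nerve_cocycle (o := id) phi_id)).
rewrite [RHS](nerve_map_full (o := id) phi_id).
by congr (nerve_map K id); apply: cocycle_ext.
Qed.

Lemma normalized_homotopy_of_hom (F1 F2 : weak_action K) :
  weak_action_hom F1 F2 ->
  normalized_homotopy (smap_of_weak_action F1) (smap_of_weak_action F2).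
Proof.
move=> t.
exists (homotopy_of_cyl (nerve_map K (cyl_base G) (cocycle_of_hom t))).
split=> [n x | n x | A].
- congr (lax_of_cocycle K (fob x)); apply: cocycle_ext => // *.
  exact: mul1g.
- by congr (lax_of_cocycle K (fob x)); apply: cocycle_ext.
- exists (smap_of_weak_action F1 0 A).
  rewrite /degenerate_edge -sfun_nat.
  congr (lax_of_cocycle K (fun=> fob A ord0)).
  have E (h : chom (ord0 : ordinal_cat 0) ord0) : fhom A h = cid (fob A ord0).
    by rewrite -fhom1; congr (fhom A); apply: ord_hom_irr.
  apply: cocycle_ext => [i j ij | i j k jk ij].
    apply: group_iso_ext => x; rewrite /= /hom_act /= E wact1.
    by case: (nat_of_ord i) => [|i']; rewrite wact1.
  rewrite /= /hom_coc /= !E wtau1 !wcoc1 mulg1.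
  by case: (nat_of_ord i) => [|i'] //; case: (nat_of_ord j).
Qed.

Lemma hom_of_normalized_homotopy (F1 F2 : weak_action K) :
  normalized_homotopy (smap_of_weak_action F1) (smap_of_weak_action F2) ->
  inhabited (weak_action_hom F1 F2).
Proof.
move=> [h [h0 h1 hv]]; pose h' := cyl_of_homotopy h.
have end0 n (x : nerve G n) :
    h' n (functor_comp (cyl_end G bot) x) = smap_of_weak_action F1 n x.
  rewrite -h0; congr (h n (_, _)).
  by case: x => *; apply: functor_ext.
have end1 n (x : nerve G n) :
    h' n (functor_comp (cyl_end G top) x) = smap_of_weak_action F2 n x.
  rewrite -h1; congr (h n (_, _)).
  by case: x => *; apply: functor_ext.
have h'_base (X : cylinder G) : lob (h' 0 (vertex X)) ord0 = cyl_base G X.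
  case: X => A i.
  have [-> | ->] : i = bot \/ i = top.
    by case: i => [[|[|i]] hi] //; [left | right]; apply: val_inj.
  - have -> : vertex ((A, bot) : cylinder G) =
        functor_comp (cyl_end G bot) (vertex A).
      exact: functor_ext.
    by rewrite end0.
  - have -> : vertex ((A, top) : cylinder G) =
        functor_comp (cyl_end G top) (vertex A).
      exact: functor_ext.
    by rewrite end1.
pose c := nerve_cocycle h'_base.
have h'E : h' = nerve_map K (cyl_base G) c := nerve_map_full h'_base.
constructor; apply: (@hom_of_cocycle _ _ _ _ c).
- apply: (@nerve_map_inj G K G id); apply: smap_ext => n x.
  by apply: etrans (end0 n x); rewrite h'E /= pullback_comp.
- apply: (@nerve_map_inj G K G id); apply: smap_ext => n x.
  by apply: etrans (end1 n x); rewrite h'E /= pullback_comp.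
- move=> A x.
  have [v Ev] := hv (vertex A).
  rewrite -cyl_of_homotopyE -/h' h'E in Ev.
  (* Over 0 -> 1 the degenerate edge is an identity of v, whose object is only
     provably A; P is the property of being an identity up to transport. *)
  have E := f_equal (fun X => total1 X bt) Ev.
  pose P B B' (f : group_iso (K B) (K B')) :=
    forall (e : B' = B) x, eq_rect B' K (f x) B e = x.
  apply: (same_ind (P := P) (same_sym E) _ erefl) => e k.
  rewrite (Prop_irrelevance e erefl) /=.
  have -> : leqnn 0 = cid (ord0 : ordinal_cat 0) by [].
  by rewrite lhom1_id.
Qed.

End MapsOfWeakActions.

Theorem theorem4p2 (G : groupoid) (K : G -> groupType) :
  exists f : cohomology_H2 K -> Sset_star_classes K, bijective f.
Proof.
pose Phi (F : weak_action_category K) :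
    {phi : smap (nerve G) (geometric_nerve (AUT K)) | over_objects phi} :=
  exist _ _ (smap_of_weak_action_over F).
apply: (generated_classes_bij (f := Phi)).
- move=> [phi phiP]; have [F E] := smap_of_weak_action_surj phiP.
  by exists F; apply: eq_exist.
- by move=> F; constructor; apply: cid.
- move=> F1 F2; split; first by move=> [t]; apply: normalized_homotopy_of_hom.
  exact: hom_of_normalized_homotopy.
Qed.
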